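(* Let $d \geq 2$ be an integer and let $\mathcal{X} = \{1\} \times \mathbb{R}^{d-1} \subseteq \mathbb{R}^d$. Let $\mathcal{W}_d$ be the set of all (constrained or unconstrained) warped-product functions $\mathcal{X} \to \mathbb{R}$ of finite elasticity, let $\mathcal{E}_d$ be the set of all (constrained or unconstrained) elastic-product functions $\mathcal{X} \to \mathbb{R}$ of finite elasticity, and let $\mathcal{L}_d$ be the set of all max-linear functions $\mathcal{X} \to \mathbb{R}$ with finitely many component functions. Then $$\mathcal{W}_d \subseteq \mathcal{E}_d = \mathcal{L}_d .$$
   Context: Warping paths. For positive integers $m,n$, a warping path in the $(m\times n)$-lattice $\{1,\dots,m\}\times\{1,\dots,n\}$ is a finite sequence $p = (p_1,\dots,p_L)$ of points $p_l = (i_l,j_l)$ of the lattice such that $p_1 = (1,1)$, $p_L = (m,n)$, and $p_{l+1}-p_l \in \{(1,0),(0,1),(1,1)\}$ for all $1 \le l < L$. The set of all such warping paths is denoted $\mathcal{P}_{m,n}$. Write $(i,j)\in p$ if $(i,j)$ is one of the points of $p$. Warped-product functions. Let $e \ge 1$ be an integer (the elasticity), $w = (w_1,\dots,w_e) \in \mathbb{R}^e$, and let $\mathcal{Q} \subseteq \mathcal{P}_{e,d}$ be nonempty (unconstrained means $\mathcal{Q} = \mathcal{P}_{e,d}$). For $x \in \mathbb{R}^d$ and $p \in \mathcal{P}_{e,d}$ put $w \ast_p x = \sum_{(i,j)\in p} w_i x_j$. The warped-product function on $\mathcal{X}$ with weight sequence $w$ constrained to $\mathcal{Q}$ is $x \mapsto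 \max\{ w \ast_p x : p \in \mathcal{Q}\}$. The set $\mathcal{W}_d$ consists of all these functions, over all $e \geq 1$, all $w\in\mathbb{R}^e$ and all nonempty $\mathcal{Q}\subseteq \mathcal{P}_{e,d}$. Elastic-product functions. Let $e \ge 1$ be an integer, $W = (w_{ij}) \in \mathbb{R}^{d\times e}$, and let $\mathcal{Q} \subseteq \mathcal{P}_{d,e}$ be nonempty. For $x \in \mathbb{R}^d$ and $p \in \mathcal{P}_{d,e}$ put $W \otimes_p x = \sum_{(i,j)\in p} w_{ij} x_i$. The elastic-product function on $\mathcal{X}$ with weight matrix $W$ constrained to $\mathcal{Q}$ is $x \mapsto \max\{ W \otimes_p x : p \in \mathcal{Q}\}$. The set $\mathcal{E}_d$ consists of all these functions, over all $e\ge 1$, all $W\in\mathbb{R}^{d\times e}$ and all nonempty $\mathcal{Q}\subseteq\mathcal{P}_{d,e}$. Max-linear functions. A max-linear function on $\mathcal{X}$ is a function $f:\mathcal{X}\to\mathbb{R}$ of the form $f(x) = \max\{ f_p(x) : p \in \mathcal{P}\}$, where $\mathcal{P}$ is a nonempty finite index set and each component is a generalized linear function $f_p(x) = w_p^{\mathsf T}\phi_p(x)$, with $\phi_p:\mathbb{R}^d\to\mathbb{R}^m$ a linear map satisfying $\phi_p(\mathcal{X})\subseteq \{1\}\times\mathbb{R}^{m-1}$ and $w_p\in\mathbb{R}^m$ (for some $m \geq 1$). *)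

(* Defs.v *)
From mathcomp Require Import all_boot all_order all_algebra.
From mathcomp Require Import all_classical all_reals.

Set Implicit Arguments.
Unset Strict Implicit.
Unset Printing Implicit Defensive.

Import Order.TTheory GRing.Theory Num.Theory.

Local Open Scope classical_set_scope.
Local Open Scope ring_scope.

(* Indices run over {0, ..., n - 1}: a path goes from (0, 0) to
   (m - 1, n - 1). *)
Definition warping_step (m n : nat) : rel ('I_m * 'I_n) :=
  fun u v => ((v.1 : nat), (v.2 : nat)) \in
    [:: (u.1.+1, (u.2 : nat)); ((u.1 : nat), u.2.+1); (u.1.+1, u.2.+1)].

Definition is_warping_path (m n : nat) (p : seq ('I_m * 'I_n)) : bool :=
  if p is u :: s then
    [&& (u.1 == 0 :> nat)%N, (u.2 == 0 :> nat)%N,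
        path (@warping_step m n) u s,
        ((last u s).1 == m.-1 :> nat)%N & ((last u s).2 == n.-1 :> nat)%N]
  else false.

Definition warping_paths (m n : nat) : set (seq ('I_m * 'I_n)) :=
  [set p | is_warping_path p].
Arguments warping_paths m n : clear implicits.

Definition is_max (R : realType) (A : set R) (y : R) : Prop :=
  A y /\ ubound A y.

(* {1} x R^(n-1), for n >= 1; the index i is the first one. *)
Definition slice (R : realType) (n : nat) : set 'cV[R]_n :=
  [set x : 'cV[R]_n | forall i : 'I_n, i = 0%N :> nat -> x i 0 = 1].
Arguments slice R n : clear implicits.

(* The type of functions on the slice itself, not on all of R^d. *)
Definition slice_fun (R : realType) (d : nat) : Type :=
  set_type (slice R d) -> R.

Definition warped_product (R : realType) (e d : nat) (w : 'cV[R]_e)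
    (p : seq ('I_e * 'I_d)) (x : 'cV[R]_d) : R :=
  \sum_(u in p) w u.1 0 * x u.2 0.

Definition elastic_product (R : realType) (d e : nat) (W : 'M[R]_(d, e))
    (p : seq ('I_d * 'I_e)) (x : 'cV[R]_d) : R :=
  \sum_(u in p) W u.1 u.2 * x u.1 0.

Definition warped_product_functions (R : realType) (d : nat) :
    set (slice_fun R d) :=
  [set f : slice_fun R d |
    exists (e : nat) (w : 'cV[R]_e) (Q : set (seq ('I_e * 'I_d))),
    [/\ (1 <= e)%N, Q `<=` warping_paths e d, Q !=set0 &
      forall x : set_type (slice R d),
        is_max [set warped_product w p (val x) | p in Q] (f x)]].
Arguments warped_product_functions R d : clear implicits.

Definition elastic_product_functions (R : realType) (d : nat) :
    set (slice_fun R d) :=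
  [set f : slice_fun R d |
    exists (e : nat) (W : 'M[R]_(d, e)) (Q : set (seq ('I_d * 'I_e))),
    [/\ (1 <= e)%N, Q `<=` warping_paths d e, Q !=set0 &
      forall x : set_type (slice R d),
        is_max [set elastic_product W p (val x) | p in Q] (f x)]].
Arguments elastic_product_functions R d : clear implicits.

Definition generalized_linear (R : realType) (d : nat) (g : slice_fun R d) :
    Prop :=
  exists (m : nat) (phi : {linear 'cV[R]_d -> 'cV[R]_m}) (w : 'cV[R]_m),
    [/\ (1 <= m)%N, phi @` slice R d `<=` slice R m &
      forall x : set_type (slice R d), g x = (w^T *m phi (val x)) 0 0].

Definition max_linear_functions (R : realType) (d : nat) :
    set (slice_fun R d) :=
  [set f : slice_fun R d |
    exists (P : finType) (g : P -> slice_fun R d),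
    [/\ (0 < #|P|)%N, forall p, generalized_linear (g p) &
      forall x : set_type (slice R d),
        is_max [set g p x | p in [set: P]] (f x)]].
Arguments max_linear_functions R d : clear implicits.

(* Main.v *)
(* Warped and elastic products are finite maxima of linear forms since a path
   only matters through its set of points. Conversely, k linear forms b_c
   (c < k) are realized on the d x k lattice by the paths running along the
   first row up to column c, straight down column c, and along the last row to
   the end. Path c collects a prefix sum in the first row, a suffix sum in the
   last row and a single entry in each other row, so telescoping weights produce
   b_c exactly; d >= 2 makes the first and the last row distinct. *)
Require Import Defs.
From mathcomp Require Import all_boot all_order all_algebra.
From mathcomp Require Import all_classical all_reals.

Import Order.TTheory GRing.Theory Num.Theory.

Local Open Scope classical_set_scope.
Local Open Scope ring_scope.

Lemma path_map_iota (T : Type) (e : rel T) (f : nat -> T) (m n : nat) :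
  (forall i, (m <= i < m + n)%N -> e (f i) (f i.+1)) ->
  path e (f m) [seq f i | i <- iota m.+1 n].
Proof.
elim: n m => [//|n IHn] m ef /=; rewrite ef ?IHn//.
  by move=> i /andP[mi im]; apply: ef; rewrite -addSnnS im (ltnW mi).
by rewrite leqnn addnS ltnS leq_addr.
Qed.

Lemma last_map_iota (T : Type) (f : nat -> T) (m n : nat) :
  last (f m) [seq f i | i <- iota m.+1 n] = f (m + n)%N.
Proof. by elim: n m => [|n IHn] m /=; rewrite ?addn0// IHn addSnnS. Qed.

Section crossing_path.
Context {d k : nat}.

Definition crossing_path (c : 'I_k.+1) : seq ('I_d.+2 * 'I_k.+1) :=
  [seq (ord0, inord j) | j <- iota 0 c.+1] ++
  [seq (inord i, inord c) | i <- iota 1 d.+1] ++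
  [seq (ord_max, inord j) | j <- iota c.+1 (k - c)].

Lemma crossing_path_warping (c : 'I_k.+1) :
  is_warping_path (crossing_path c).
Proof.
pose f1 j : 'I_d.+2 * 'I_k.+1 := (ord0, inord j).
pose f2 i : 'I_d.+2 * 'I_k.+1 := (inord i, inord c).
pose f3 j : 'I_d.+2 * 'I_k.+1 := (ord_max, inord j).
have ck : (c <= k)%N by rewrite -ltnS.
(* Consecutive legs meet in a corner that only the earlier one lists, so each leg runs on from the
   last point of the previous leg. *)
have f12 : f1 c = f2 0%N by congr pair; apply: val_inj; rewrite /= inordK.
have f23 : f2 d.+1 = f3 c by congr pair; apply: val_inj; rewrite /= inordK.
have -> : crossing_path c = f1 0%N :: [seq f1 i | i <- iota 1 c] ++
    [seq f2 i | i <- iota 1 d.+1] ++ [seq f3 i | i <- iota c.+1 (k - c)] by [].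
rewrite /is_warping_path !cat_path !last_cat !(last_map_iota _ f1) add0n f12.
rewrite !(last_map_iota _ f2) add0n f23 (last_map_iota _ f3) subnKC//.
apply/and5P; split; rewrite ?inordK//.
apply/and3P; split; apply: path_map_iota => i /andP[_ ilt].
- have ik : (i < k)%N by apply: leq_trans ck.
  by rewrite /warping_step /= !inordK// ?inE ?eqxx ?orbT// ltnS ltnW.
- by rewrite /warping_step /= !inordK// ?inE ?eqxx ?orbT// ltnS ltnW.
- rewrite subnKC// in ilt.
  by rewrite /warping_step /= !inordK// ?inE ?eqxx ?orbT// ltnS ltnW.
Qed.

(** Sorted by row, so that a sum along row [i] becomes a prefix, a single column or a suffix. *)
Lemma mem_crossing_path (c : 'I_k.+1) (i : 'I_d.+2) (j : 'I_k.+1) :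
  ((i, j) \in crossing_path c) =
  [|| (i == ord0) && (j <= c)%N, (i != ord0) && (j == c)
    | (i == ord_max) && (c < j)%N].
Proof.
rewrite /crossing_path !mem_cat; congr [|| _, _ | _].
- apply/mapP/andP => [[j' + [-> ->]]|[/eqP-> jc]].
    rewrite mem_iota /= add0n ltnS => jc.
    by rewrite inordK// (leq_ltn_trans jc).
  by exists (nat_of_ord j); rewrite ?mem_iota ?inord_val.
- rewrite inord_val; apply/mapP/andP => [[i' + [-> ->]]|[i0 /eqP->]].
    rewrite mem_iota => /andP[i0 ilt]; split=> //.
    by rewrite -val_eqE /= inordK// -lt0n.
  by exists (nat_of_ord i); rewrite ?inord_val// mem_iota lt0n i0 /= add1n.
- apply/mapP/andP => [[j' + [-> ->]]|[/eqP-> cj]].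
    rewrite mem_iota addSn subnKC ?leq_ord// => /andP[cj jk].
    by rewrite inordK.
  exists (nat_of_ord j); rewrite ?inord_val// mem_iota cj addSn.
  by rewrite subnKC ?leq_ord// ltn_ord.
Qed.

End crossing_path.

Section crossing_weights.
Context {R : realType} {d k : nat} (b : 'I_k.+1 -> 'cV[R]_d.+2).

(* Extended by 0 past the last column, which terminates the telescoping sum of
   the last row. *)
Let B (i : 'I_d.+2) (j : nat) : R :=
  if (j < k.+1)%N then b (inord j) i 0 else 0.

(** Backward differences in the first row sum to [B i c] over the columns up to [c]; negated forward
    differences in the last row sum to [B i c] from [c] on. *)
Definition crossing_weights : 'M[R]_(d.+2, k.+1) :=
  \matrix_(i, j)
    if i == ord0 then B i j - (if nat_of_ord j is j'.+1 then B i j' else 0)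
    else if i == ord_max then B i j - B i j.+1
    else B i j.

Lemma sum_crossing_weights (c : 'I_k.+1) (i : 'I_d.+2) :
  \sum_(j | (i, j) \in crossing_path c) crossing_weights i j = b c i 0.
Proof.
have BE (j : 'I_k.+1) : B i j = b j i 0 by rewrite /B ltn_ord inord_val.
under eq_bigl do rewrite mem_crossing_path.
under eq_bigr do rewrite mxE.
rewrite -BE; have [i0|i0] /= := eqVneq i ord0.
  rewrite i0; under eq_bigl do rewrite orbF -ltnS.
  (* [S] is [B i] shifted by one column with [S 0 = 0], so each first-row weight is
     [S j.+1 - S j]. *)
  pose S j := if j is j'.+1 then B i j' else 0.
  rewrite -i0 -(big_ord_widen _ (fun j => B i j - S j)) //.
  rewrite -(big_mkord xpredT (fun j => S j.+1 - S j)).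
  by rewrite telescope_sumr//= subr0.
have [im|im] /= := eqVneq i ord_max.
  (* The point in column [c] and those past it merge into the suffix [c <= j]. *)
  under eq_bigl do rewrite eq_sym -val_eqE -leq_eqVlt.
  rewrite -(big_mkord (fun j => c <= j)%N (fun j => B i j - B i j.+1)).
  rewrite -(big_nat_widenl _ 0 _ xpredT)//.
  rewrite (telescope_sumr_eq (fun j => - B i j)).
  (* The sum ends at column [k.+1], where [B] vanishes. *)
  - by rewrite opprK {1}/B ltnn oppr0 add0r.
  - exact: ltnW.
  - by move=> j _; rewrite opprK addrC.
by under eq_bigl do rewrite orbF; rewrite big_pred1_eq.
Qed.

Lemma elastic_product_crossing (c : 'I_k.+1) (x : 'cV[R]_d.+2) :
  elastic_product crossing_weights (crossing_path c) x =
  \sum_i b c i 0 * x i 0.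
Proof.
rewrite /elastic_product.
under [RHS]eq_bigr do rewrite -sum_crossing_weights mulr_suml.
by rewrite pair_big_dep; apply: eq_bigl => -[].
Qed.

End crossing_weights.

Section generalized_linear.
Context {R : realType} {d : nat}.

(** By linearity of [phi], the coefficients are the values of the form at the standard basis
    vectors. *)
Lemma generalized_linear_coef (g : slice_fun R d) :
  generalized_linear g ->
  exists b : 'cV[R]_d, forall x : set_type (slice R d),
    g x = \sum_i b i 0 * val x i 0.
Proof.
move=> [m [phi [w [_ _ gE]]]].
exists (\col_i (w^T *m phi (delta_mx i 0)) 0 0) => x.
rewrite gE {1}(matrix_sum_delta (val x)) linear_sum mulmx_sumr summxE.
by apply: eq_bigr => i _; rewrite big_ord1 linearZ -scalemxAr !mxE mulrC.
Qed.

(** Take the identity for [phi] and collect the coefficients attached to each coordinate. *)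
Lemma generalized_linear_sum (T : finType) (A : {set T}) (c : T -> R)
    (r : T -> 'I_d) : (1 <= d)%N ->
  generalized_linear
    (fun x : set_type (slice R d) => \sum_(u in A) c u * val x (r u) 0).
Proof.
move=> d0; exists d, idfun, (\col_i \sum_(u in A | r u == i) c u).
split=> // x; rewrite mxE (partition_big r xpredT)//=; apply: eq_bigr => i _.
by rewrite !mxE mulr_suml; apply: eq_bigr => u /andP[_ /eqP->].
Qed.

(** Covers both products: [r u] is the coordinate of [x] read at the lattice point [u], and [c u]
    its weight. As [seq T] is not a finite type, components are indexed by the point sets of paths,
    taken in [{set T}]. *)
Lemma max_linear_sum (T : finType) (c : T -> R) (r : T -> 'I_d)
    (Q : set (seq T)) (f : slice_fun R d) :
  (1 <= d)%N -> Q !=set0 ->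
  (forall x : set_type (slice R d),
    is_max [set \sum_(u in p) c u * val x (r u) 0 | p in Q] (f x)) ->
  max_linear_functions R d f.
Proof.
move=> d0 [q Qq] fmax.
pose support (A : {set T}) := `[< exists2 p, Q p & A = [set u in p]%SET >].
pose g (A : {A | support A}) (x : set_type (slice R d)) : R :=
  \sum_(u in val A) c u * val x (r u) 0.
have sup p : Q p -> support [set u in p]%SET
  by move=> Qp; apply/asboolP; exists p.
pose el p (Qp : Q p) : {A | support A} := Sub _ (sup p Qp).
exists {A | support A}, g; split=> [|A|x].
- by apply/card_gt0P; exists (el q Qq).
- exact: generalized_linear_sum.
- rewrite [X in is_max X _](_ : _ =
    [set \sum_(u in p) c u * val x (r u) 0 | p in Q])//.
  apply/seteqP; split=> [_ [[A sA] _ <-]|_ [p Qp <-]] /=.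
    have /asboolP[p Qp Ap] := sA; exists p => //.
    by rewrite /g /= Ap; apply: eq_bigl => u; rewrite inE.
  by exists (el p Qp) => //=; apply: eq_bigl => u; rewrite inE.
Qed.

End generalized_linear.

Lemma warped_product_max_linear (R : realType) (d : nat) : (1 <= d)%N ->
  warped_product_functions R d `<=` max_linear_functions R d.
Proof.
move=> d0 f [e [w [Q [_ _ Q0 fmax]]]].
exact: (@max_linear_sum _ _ _ (fun u => w u.1 0) (fun u => u.2) Q).
Qed.

Lemma elastic_product_max_linear (R : realType) (d : nat) : (1 <= d)%N ->
  elastic_product_functions R d `<=` max_linear_functions R d.
Proof.
move=> d0 f [e [W [Q [_ _ Q0 fmax]]]].
exact: (@max_linear_sum _ _ _ (fun u => W u.1 u.2) (fun u => u.1) Q).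
Qed.

Lemma max_linear_elastic_product (R : realType) (d : nat) : (2 <= d)%N ->
  max_linear_functions R d `<=` elastic_product_functions R d.
Proof.
case: d => [|[|d]] // _ f [P [g [P0 /(_ _)/generalized_linear_coef gl fmax]]].
have [b gE] := choice gl.
case k: #|P| P0 => [//|k'] _.
(* One column per component: [rk] numbers the components and [un] recovers them. *)
pose rk p : 'I_k'.+1 := cast_ord k (enum_rank p).
pose un c : P := enum_val (cast_ord (esym k) c).
have rkK p : un (rk p) = p by rewrite /un /rk cast_ordK enum_rankK.
exists k'.+1, (crossing_weights (b \o un)), (range crossing_path).
split=> // [_ [c _ <-]||x].
- exact: crossing_path_warping.
- by exists (crossing_path ord0), ord0.
- rewrite [X in is_max X _](_ : _ = [set g p x | p in [set: P]])//.
  apply/seteqP; split=> [_ [_ [c _ <-] <-]|_ [p _ <-]].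
    exists (un c) => //.
    by rewrite elastic_product_crossing gE.
  exists (crossing_path (rk p)); first by exists (rk p).
  by rewrite elastic_product_crossing gE /= rkK.
Qed.

Theorem theorem3p4 (R : realType) (d : nat) (hd : (2 <= d)%N) :
  warped_product_functions R d `<=` elastic_product_functions R d /\
  elastic_product_functions R d = max_linear_functions R d.
Proof.
have d0 : (1 <= d)%N by exact: ltnW.
have EL : elastic_product_functions R d = max_linear_functions R d.
  apply/seteqP; split; first exact: elastic_product_max_linear.
  exact: max_linear_elastic_product.
(* Warped products are compared with elastic ones through max-linear functions. *)
by split=> //; rewrite EL; apply: warped_product_max_linear.
Qed.
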